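(* Let $\mathcal L$ and $\mathcal L_n$ ($n\ge 0$) be real separable Hilbert spaces and let $\Phi_n:\mathcal L\to\mathcal L_n$ be linear operators with $\lim_{n\to\infty}\|\Phi_n u\|_{\mathcal L_n}=\|u\|_{\mathcal L}$ for all $u\in\mathcal L$. Let $(\mathcal E,\mathcal H)$ be a bilinear closed form on $\mathcal L$ and, for each $n$, let $(\mathcal E^n,\mathcal H_n)$ be a bilinear closed form on $\mathcal L_n$, all of them satisfying $(\mathcal E.1)$ and $(\mathcal E.2)$ with one common constant $\alpha_0\in\mathbb R$ (the sector constants $K_n\ge 1$ may depend on $n$). Let $(G_\alpha)_{\alpha>\alpha_0}$ and $(G^n_\alpha)_{\alpha>\alpha_0}$ be the associated resolvents. Then: (i) $\mathcal E^n$ Mosco-converges to $\mathcal E$ if and only if (F1) and (F2') hold. (ii) $\mathcal E^n$ Mosco-converges to $\mathcal E$ if and only if $G^n_\alpha$ strongly converges to $G_\alpha$ for every $\alpha>\alpha_0$.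
   Context: **Closed forms.** Let $\mathcal L$ be a real separable Hilbert space and $\mathcal E$ a bilinear form with domain $\mathcal H$, a dense linear subspace of $\mathcal L$. Let $\mathcal E^s(u,v)=\frac12(\mathcal E(u,v)+\mathcal E(v,u))$ and, for $\alpha\in\mathbb R$, $\mathcal E_\alpha=\mathcal E+\alpha\langle\cdot,\cdot\rangle_{\mathcal L}$, $\mathcal E^s_\alpha=\mathcal E^s+\alpha\langle\cdot,\cdot\rangle_{\mathcal L}$. The form is a *bilinear closed form* with constant $\alpha_0\in\mathbb R$ if - $(\mathcal E.1)$ $\mathcal E^s_{\alpha_0}$ is positive definite, in the sense $\mathcal E^s_{\alpha_0}(u,u)\ge0$ for $u\in\mathcal H$, and $\mathcal H$ with the inner product $\langle\cdot,\cdot\rangle_{\mathcal H}:=\mathcal E^s_{\alpha_0+1}$ is a Hilbert space (norm $\|\cdot\|_{\mathcal H}$); - $(\mathcal E.2)$ there is $K\ge1$ with $|\mathcal E_{\alpha_0+1}(u,v)|\le K\,\mathcal E_{\alpha_0+1}(u,u)^{1/2}\mathcal E_{\alpha_0+1}(v,v)^{1/2}$ for all $u,v\in\mathcal H$. The associated resolvent $(G_\alpha)_{\alpha>\alpha_0}$ is the unique strongly continuous contraction resolvent on $\mathcal L$ (resolvent equation, $\|(\alpha-\alpha_0)G_\alpha\|\le 1$, $\alpha G_\alpha f\to f$ as $\alpha\to\infty$) with $G_\alpha(\mathcal L)\subset\mathcal H$ and $\mathcal E_\alpha(G_\alpha f,u)=\langle f,u\rangle_{\mathcal L}$ for all $f\in\mathcal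 L$, $u\in\mathcal H$. **Convergence along $\mathcal L_n\to\mathcal L$.** For $u_n\in\mathcal L_n$, $u\in\mathcal L$: $(u_n)$ *strongly converges* to $u$ if $\|\Phi_nu-u_n\|_{\mathcal L_n}\to0$; $(u_n)$ *weakly converges* to $u$ if $\langle u_n,v_n\rangle_{\mathcal L_n}\to\langle u,v\rangle_{\mathcal L}$ for every sequence $v_n\in\mathcal L_n$ strongly converging to some $v\in\mathcal L$. The same definitions are used along subsequences $n_k\uparrow\infty$. Bounded operators $A_n$ on $\mathcal L_n$ *strongly converge* to a bounded operator $A$ on $\mathcal L$ if $A_nu_n$ strongly converges to $Au$ whenever $u_n$ strongly converges to $u$. **Mosco convergence.** For $u\in\mathcal H_n$ let $\Theta^n(u)=\sup\{\mathcal E^n_{\alpha_0+1}(v,u): v\in\mathcal H_n,\ \|v\|_{\mathcal H_n}=1\}$. $\mathcal E^n$ *Mosco-converges* to $\mathcal E$ if (F1) and (F2) hold: - (F1) If $u_n\in\mathcal H_n$ weakly converges to $u\in\mathcal L$ and $\liminf_n\Theta^n(u_n)<\infty$, then $u\in\mathcal H$. - (F2) For any sequence $u_n\in\mathcal H_n$ weakly converging to some $u\in\mathcal H$ and any $v\in\mathcal H$, there is a sequence $v_n\in\mathcal H_n$ strongly converging to $v$ with $\lim_n\mathcal E^n(v_n,u_n)=\mathcal E(v,u)$. Further condition: - (F2') For any $n_k\uparrow\infty$ and $u_k\in\mathcal H_{n_k}$ weakly converging to some $u\in\mathcal H$ with $\sup_k\Theta^{n_k}(u_k)<\infty$, there is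 a dense subset $C$ of $\mathcal H$ such that for all $v\in C$ there is a sequence $v_k\in\mathcal H_{n_k}$ strongly converging to $v$ with $\liminf_k\mathcal E^{n_k}(v_k,u_k)\le\mathcal E(v,u)$. *)

(* Defs.v *)
From HB Require Import structures.
From mathcomp Require Import all_boot all_order all_algebra.
From mathcomp Require Import all_classical all_reals all_analysis.

Set Implicit Arguments.
Unset Strict Implicit.
Unset Printing Implicit Defensive.

Import Order.TTheory GRing.Theory Num.Theory.
Import numFieldNormedType.Exports.

Local Open Scope classical_set_scope.
Local Open Scope ring_scope.

HB.mixin Record NormedModule_hasInnerProduct (R : realType) V
    & NormedModule R V := {
  dotp : V -> V -> R ;
  dotpC : commutative dotp ;
  dotp_scalar : forall v, scalar (dotp^~ v) ;
  dotp_norm : forall u, dotp u u = `|u| ^+ 2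
}.

#[short(type="hilbertType")]
HB.structure Definition Hilbert (R : realType) :=
  {V of CompleteNormedModule R V & NormedModule_hasInnerProduct R V}.

Definition separable (T : topologicalType) :=
  exists2 D : set T, countable D & dense D.

(* A form with domain H is given by a function E on the whole space L, of
   which only the restriction to H is ever used. *)

Definition symmetric_part (R : realType) (L : hilbertType R)
    (E : L -> L -> R) (u v : L) : R :=
  (E u v + E v u) / 2.

Definition shift_form (R : realType) (L : hilbertType R)
    (E : L -> L -> R) (a : R) (u v : L) : R :=
  E u v + a * dotp u v.

Definition form_norm (R : realType) (L : hilbertType R)
    (E : L -> L -> R) (a0 : R) (u : L) : R :=
  Num.sqrt (shift_form (symmetric_part E) (a0 + 1) u u).

(* Definiteness of the inner product on H is not a separate requirement: it
   follows from closed_form_ge0, which gives `|u| <= form_norm E a0 u on H. *)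
Record closed_form (R : realType) (L : hilbertType R)
    (E : L -> L -> R) (H : set L) (a0 : R) : Prop := {
  closed_form_domain0 : H 0 ;
  closed_form_domainP : forall (a : R) (u v : L), H u -> H v -> H (a *: u + v) ;
  closed_form_dense : dense H ;
  closed_form_linearl : forall (a : R) (u v w : L), H u -> H v -> H w ->
    E (a *: u + v) w = a * E u w + E v w ;
  closed_form_linearr : forall (a : R) (u v w : L), H u -> H v -> H w ->
    E w (a *: u + v) = a * E w u + E w v ;
  closed_form_ge0 : forall u, H u -> 0 <= shift_form (symmetric_part E) a0 u u ;
  closed_form_complete : forall u_ : nat -> L, (forall n, H (u_ n)) ->
    (forall e : R, 0 < e ->
      exists N, forall m n, (N <= m)%N -> (N <= n)%N ->
        form_norm E a0 (u_ m - u_ n) < e) ->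
    exists2 u, H u & form_norm E a0 (u_ n - u) @[n --> \oo] --> (0 : R) ;
  closed_form_sector : exists2 K : R, 1 <= K &
    forall u v, H u -> H v ->
      `|shift_form E (a0 + 1) u v| <=
        K * Num.sqrt (shift_form E (a0 + 1) u u)
          * Num.sqrt (shift_form E (a0 + 1) v v)
}.

(* G a is only meaningful for a0 < a. *)
Record resolvent_of (R : realType) (L : hilbertType R)
    (E : L -> L -> R) (H : set L) (a0 : R) (G : R -> L -> L) : Prop := {
  resolvent_linear : forall a, a0 < a -> linear (G a) ;
  resolvent_contraction : forall a f, a0 < a ->
    `|(a - a0) *: G a f| <= `|f| ;
  resolvent_equation : forall a b f, a0 < a -> a0 < b ->
    G a f - G b f = (b - a) *: G a (G b f) ;
  resolvent_continuous : forall f, a *: G a f @[a --> +oo] --> f ;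
  resolvent_domain : forall a f, a0 < a -> H (G a f) ;
  resolvent_form : forall a f u, a0 < a -> H u ->
    shift_form E a (G a f) u = dotp f u
}.

Definition strongly_cvg (R : realType) (L : hilbertType R)
    (Ln : nat -> hilbertType R) (Phi : forall n, {linear L -> Ln n})
    (u_ : forall n, Ln n) (u : L) : Prop :=
  `|Phi n u - u_ n| @[n --> \oo] --> (0 : R).

Definition weakly_cvg (R : realType) (L : hilbertType R)
    (Ln : nat -> hilbertType R) (Phi : forall n, {linear L -> Ln n})
    (u_ : forall n, Ln n) (u : L) : Prop :=
  forall (v_ : forall n, Ln n) (v : L), strongly_cvg Phi v_ v ->
    dotp (u_ n) (v_ n) @[n --> \oo] --> dotp u v.

Definition operators_strongly_cvg (R : realType) (L : hilbertType R)
    (Ln : nat -> hilbertType R) (Phi : forall n, {linear L -> Ln n})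
    (A_ : forall n, Ln n -> Ln n) (A : L -> L) : Prop :=
  forall (u_ : forall n, Ln n) (u : L), strongly_cvg Phi u_ u ->
    strongly_cvg Phi (fun n => A_ n (u_ n)) (A u).

(* Theta takes the value -oo when H = 0, which is harmless since it only occurs
   in conditions of the form _ < +oo. *)
Definition Theta (R : realType) (L : hilbertType R)
    (E : L -> L -> R) (H : set L) (a0 : R) (u : L) : \bar R :=
  ereal_sup [set (shift_form E (a0 + 1) v u)%:E
            | v in [set v | H v /\ form_norm E a0 v = 1]].

Definition mosco_F1 (R : realType) (L : hilbertType R)
    (Ln : nat -> hilbertType R) (Phi : forall n, {linear L -> Ln n})
    (H : set L) (En : forall n, Ln n -> Ln n -> R) (Hn : forall n, set (Ln n))
    (a0 : R) : Prop :=
  forall (u_ : forall n, Ln n) (u : L), (forall n, Hn n (u_ n)) ->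
    weakly_cvg Phi u_ u ->
    (limn_einf (fun n => Theta (En n) (Hn n) a0 (u_ n)) < +oo)%E ->
    H u.

Definition mosco_F2 (R : realType) (L : hilbertType R)
    (Ln : nat -> hilbertType R) (Phi : forall n, {linear L -> Ln n})
    (E : L -> L -> R) (H : set L)
    (En : forall n, Ln n -> Ln n -> R) (Hn : forall n, set (Ln n)) : Prop :=
  forall (u_ : forall n, Ln n) (u : L), (forall n, Hn n (u_ n)) ->
    weakly_cvg Phi u_ u -> H u ->
    forall v, H v ->
    exists v_ : forall n, Ln n,
      [/\ forall n, Hn n (v_ n),
          strongly_cvg Phi v_ v
        & En n (v_ n) (u_ n) @[n --> \oo] --> E v u].

Definition mosco_cvg (R : realType) (L : hilbertType R)
    (Ln : nat -> hilbertType R) (Phi : forall n, {linear L -> Ln n})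
    (E : L -> L -> R) (H : set L)
    (En : forall n, Ln n -> Ln n -> R) (Hn : forall n, set (Ln n))
    (a0 : R) : Prop :=
  mosco_F1 Phi H En Hn a0 /\ mosco_F2 Phi E H En Hn.

(* Density in H is with respect to the norm form_norm E a0.  Convergence along
   the subsequence n_ is convergence for the spaces Ln (n_ k) and the maps
   Phi (n_ k), k ranging over nat. *)
Definition mosco_F2' (R : realType) (L : hilbertType R)
    (Ln : nat -> hilbertType R) (Phi : forall n, {linear L -> Ln n})
    (E : L -> L -> R) (H : set L)
    (En : forall n, Ln n -> Ln n -> R) (Hn : forall n, set (Ln n))
    (a0 : R) : Prop :=
  forall n_ : nat -> nat, {homo n_ : i j / (i < j)%N} ->
  forall (u_ : forall k, Ln (n_ k)) (u : L), (forall k, Hn (n_ k) (u_ k)) ->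
    @weakly_cvg R L (fun k => Ln (n_ k)) (fun k => Phi (n_ k)) u_ u -> H u ->
    (ereal_sup (range (fun k => Theta (En (n_ k)) (Hn (n_ k)) a0 (u_ k)))
       < +oo)%E ->
    exists C : set L,
      [/\ C `<=` H,
          forall w (e : R), H w -> 0 < e ->
            exists2 v, C v & form_norm E a0 (w - v) < e
        & forall v, C v ->
            exists v_ : forall k, Ln (n_ k),
              [/\ forall k, Hn (n_ k) (v_ k),
                  @strongly_cvg R L (fun k => Ln (n_ k))
                    (fun k => Phi (n_ k)) v_ v
                & (limn_einf (fun k => (En (n_ k) (v_ k) (u_ k))%:E)
                     <= (E v u)%:E)%E]].

(* Main.v *)
Require Import Defs.
From mathcomp Require Import all_boot all_order all_algebra.
From mathcomp Require Import all_classical all_reals all_analysis.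
From mathcomp Require Import ring lra.

Set Implicit Arguments.
Unset Strict Implicit.
Unset Printing Implicit Defensive.

Import Order.TTheory GRing.Theory Num.Theory.
Import numFieldNormedType.Exports.

Local Open Scope classical_set_scope.
Local Open Scope ring_scope.

(** Mosco convergence implies (F1) and (F2'), these imply convergence of the
resolvents, and that in turn implies Mosco convergence.

Since the sector constants K_n are not uniform, Theta^n (G^n_a f) need not be
bounded, but the adjoint resolvent u = G*_a h, given by E_a(v, u) = <v, h> for
all v in H, satisfies Theta(u) <= C |h| with C independent of n.  Hence weak
limits of G*^n_a h_n lie in H by (F1) and are identified with G*_a h by (F2'),
so G*^n_a h_n converges weakly whenever h_n is bounded and converges weakly.
By duality G^n_a f_n converges weakly for f_n strongly convergent; pairing it
with itself gives |G^n_a f_n|^2 = <f_n, G*^n_a G^n_a f_n> -> |G_a f|^2, which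
makes the convergence strong.

Conversely, let b = a0 + 1 and let G^n_b converge.  If Theta^n(u_n) <= M along
a subsequence, then passing to the limit in
<Phi_n g, u_n> = E^n_b(G^n_b Phi_n g, u_n) <= M |G^n_b Phi_n g|_H gives
<g, u> <= M |G_b g|_H for all g; this keeps l G_l u bounded in H as l -> oo and
so forces u into H.  For (F2), a v in the range of G_b, say v = G_b g, is
approximated by G^n_b Phi_n g, and the range of G_b is dense in H. *)

(** * Inner products and the Riesz representation *)

Section InnerProduct.
Context {R : realType} {L : hilbertType R}.
Implicit Types (u v w : L) (a : R).

Lemma dotpDl u v w : dotp (u + v) w = dotp u w + dotp v w.
Proof. by rewrite -[u in LHS]scale1r dotp_scalar mul1r. Qed.

Lemma dotp0l w : dotp 0 w = 0.
Proof. by apply: (addrI (dotp 0 w)); rewrite -dotpDl !addr0. Qed.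

Lemma dotpZl a u w : dotp (a *: u) w = a * dotp u w.
Proof. by rewrite -[a *: u]addr0 dotp_scalar dotp0l addr0. Qed.

Lemma dotpNl u w : dotp (- u) w = - dotp u w.
Proof. by rewrite -scaleN1r dotpZl mulN1r. Qed.

Lemma dotpBl u v w : dotp (u - v) w = dotp u w - dotp v w.
Proof. by rewrite dotpDl dotpNl. Qed.

Lemma dotpDr u v w : dotp w (u + v) = dotp w u + dotp w v.
Proof. by rewrite dotpC dotpDl !(dotpC _ w). Qed.

Lemma dotpZr a u w : dotp w (a *: u) = a * dotp w u.
Proof. by rewrite dotpC dotpZl (dotpC _ w). Qed.

Lemma dotpBr u v w : dotp w (u - v) = dotp w u - dotp w v.
Proof. by rewrite dotpC dotpBl !(dotpC _ w). Qed.

Lemma sqr_normB u v : `|u - v| ^+ 2 = `|u| ^+ 2 - 2 * dotp u v + `|v| ^+ 2.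
Proof.
rewrite -!dotp_norm dotpBl !dotpBr (dotpC v u); ring.
Qed.

Lemma cauchy_schwarz u v : `|dotp u v| <= `|u| * `|v|.
Proof.
have [->|v0] := eqVneq v 0; first by rewrite dotpC dotp0l !normr0 mulr0.
have v_gt0 : 0 < `|v| ^+ 2 by rewrite exprn_gt0 // normr_gt0.
have := sqr_ge0 `| `|v| ^+ 2 *: u - dotp u v *: v|.
rewrite -dotp_norm dotpBl !dotpBr !dotpZl !dotpZr !dotp_norm (dotpC v u) => h.
have {}h : 0 <= `|v| ^+ 2 * ((`|u| * `|v|) ^+ 2 - dotp u v ^+ 2).
  by rewrite (le_trans h)// le_eqVlt; apply/orP; left; apply/eqP; ring.
rewrite -(@ler_pXn2r _ 2)// ?nnegrE ?mulr_ge0// real_normK ?num_real//.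
by rewrite -subr_ge0 -(pmulr_rge0 _ v_gt0).
Qed.

Lemma dotp_le u v : dotp u v <= `|u| * `|v|.
Proof. exact: le_trans (ler_norm _) (cauchy_schwarz u v). Qed.

Lemma cvg_dotpr {T : Type} {F : set_system T} {FF : Filter F} (p : T -> L) x h :
  p n @[n --> F] --> x -> dotp h (p n) @[n --> F] --> dotp h x.
Proof.
move=> px; apply/cvgrPdist_lt => e e0.
have h1 : 0 < `|h| + 1 by rewrite ltr_wpDl.
have /cvgrPdist_lt/(_ _ (divr_gt0 e0 h1)) := px; apply: filterS => n.
rewrite ltr_pdivlMr// -dotpBr; apply: le_lt_trans.
rewrite (le_trans (cauchy_schwarz _ _))// mulrC ler_wpM2l// lerDl.
exact: ler01.
Qed.

End InnerProduct.

(** [D] is the supremum over [N] of the infimum of [q] on [C N], obtained as the infimum of the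
    levels that [q] reaches from above in every [C N]. A constant [C] gives plain minimizing
    sequences; shrinking sets give minimization near a point. *)
Lemma near_minimizers {R : realType} {V : Type} (C : nat -> set V)
    (q : V -> R) (m M : R) :
  (forall N y, C N y -> m <= q y) ->
  (forall N, exists2 y, C N y & q y <= M) ->
  exists D, (forall e, 0 < e -> exists N, forall y, C N y -> D - e < q y) /\
    (exists p : nat -> V, forall N, C N (p N) /\ q (p N) <= D + N.+1%:R^-1).
Proof.
move=> qm qM.
pose B := [set D : R | forall N, exists2 y, C N y & q y <= D].
have Binf : has_inf B.
  split; first by exists M.
  exists m => D /(_ 0%N)[y Cy yD].
  exact: le_trans (qm _ _ Cy) yD.
exists (inf B); split.
  move=> e e0; have : ~ B (inf B - e).
    by move=> /(ge_inf (proj2 Binf)); lra.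
  move=> /existsNP[N hN]; exists N => y Cy; rewrite ltNge; apply/negP => hy.
  by apply: hN; exists y.
suff /choice[p hp] : forall N, exists y, C N y /\ q y <= inf B + N.+1%:R^-1.
  by exists p.
move=> N; have N0 : (0 : R) < N.+1%:R^-1 by rewrite invr_gt0.
have [D BD Dlt] := inf_adherent N0 Binf.
have [y Cy yD] := BD N; exists y; split => //.
by rewrite (le_trans yD)// ltW.
Qed.

Lemma invS_lt {R : realType} (e : R) : 0 < e ->
  exists N, forall n, (N <= n)%N -> n.+1%:R^-1 < e.
Proof.
move=> e0; have [N _ HN] := near_infty_natSinv_lt (PosNum e0).
by exists N => n /HN.
Qed.

Lemma cvg0_eps {R : realType} (x : nat -> R) :
  x n @[n --> \oo] --> (0 : R) <->
  forall e, 0 < e -> exists N, forall n, (N <= n)%N -> `|x n| < e.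
Proof.
split=> [/cvgrPdist_lt h e /h[N _ hN]|h].
  by exists N => n /hN /=; rewrite sub0r normrN.
apply/cvgrPdist_lt => e /h[N hN]; exists N => // n /= /hN.
by rewrite sub0r normrN.
Qed.

Section Riesz.
Context {R : realType} {L : hilbertType R}.

(** The representative is the minimizer of [|u|^2 - 2 l u]: the parallelogram law makes minimizing
    sequences Cauchy, and the first variation at the limit is the claim. *)
Lemma riesz (l : L -> R) (M : R) :
  (forall (a : R) u v, l (a *: u + v) = a * l u + l v) ->
  (forall u, l u <= M * `|u|) ->
  exists x, forall h, l h = dotp h x.
Proof.
move=> lin bnd.
have lD u v : l (u + v) = l u + l v by rewrite -[u]scale1r lin mul1r scale1r.
have l0 : l 0 = 0 by apply: (addrI (l 0)); rewrite -lD !addr0.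
have lZ a u : l (a *: u) = a * l u by rewrite -[_ *: _]addr0 lin l0 addr0.
pose q (u : L) := dotp u u - 2 * l u.
have [||D [Dlow [p Hp]]] := @near_minimizers R L (fun _ => setT) q (- M ^+ 2) 0.
- move=> _ y _; rewrite /q dotp_norm.
  have := bnd y; have := sqr_ge0 (`|y| - M); nra.
- by move=> _; exists 0 => //; rewrite /q dotp0l l0 mulr0 subrr.
have Dle y e : 0 < e -> D - e < q y by move=> /Dlow[N /(_ y)]; apply.
have Dle' y : D <= q y.
  by rewrite leNgt; apply/negP => yD; have := Dle y (D - q y); lra.
(* The linear parts cancel in [2 q y + 2 q z - 4 q ((y + z) / 2) = |y - z|^2], and [q] at the
   midpoint is at least [D]. *)
have close y z : `|y - z| ^+ 2 <= 2 * (q y - D) + 2 * (q z - D).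
  have := Dle' (2^-1 *: (y + z)).
  rewrite /q lZ lD -dotp_norm dotpZl dotpZr dotpBl dotpDl !dotpBr !dotpDr.
  by rewrite (dotpC z y) => h; lra.
have pc : cauchy (p @ \oo).
  apply/cauchy_ballP => e e0.
  have e20 : 0 < e ^+ 2 / 4 by rewrite divr_gt0 ?exprn_gt0.
  have [N hN] := invS_lt e20.
  exists (p @` [set n | (N <= n)%N], p @` [set n | (N <= n)%N]).
    by split; exists N => // n /= Nn; exists n.
  move=> [_ _] /= [[n Nn <-] [k Nk <-]].
  rewrite -ball_normE /=.
  rewrite -(@ltr_pXn2r _ 2)// ?nnegrE// ?(ltW e0)//.
  rewrite (le_lt_trans (close _ _))//.
  have := hN _ Nn; have := hN _ Nk; have [_] := Hp n; have [_] := Hp k.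
  move: (n.+1%:R^-1) (k.+1%:R^-1) => *; lra.
have /cvg_ex[x px] : cvg (p n @[n --> \oo]) by exact: cauchy_cvg.
have ph h : dotp h (p n) @[n --> \oo] --> dotp h x by exact: cvg_dotpr.
exists x => h; apply/eqP; rewrite eq_sym -subr_eq0; apply/eqP.
set d := dotp h x - l h.
(* The variation is taken at [p n], where [q (p n + t *: h) >= D >= q (p n) - 1/(n+1)], and only
   then does [n] go to infinity. *)
have var t : 0 <= t ^+ 2 * `|h| ^+ 2 + 2 * t * d.
  have : (t ^+ 2 * `|h| ^+ 2 + 2 * t * (dotp h (p n) - l h) + n.+1%:R^-1)
      @[n --> \oo] --> t ^+ 2 * `|h| ^+ 2 + 2 * t * d + 0.
    apply: cvgD; last exact: cvg_harmonic.
    apply: cvgD; first exact: cvg_cst.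
    by apply: cvgMr; apply: cvgB => //; exact: cvg_cst.
  rewrite addr0 => /cvgr_to_ge; apply; near=> n.
  have := Dle' (p n + t *: h); have [_] := Hp n.
  rewrite /q lD lZ !dotpDl !dotpDr !dotpZl !dotpZr (dotpC (p n) h) -dotp_norm.
  by move: (n.+1%:R^-1) => *; lra.
have h1 : 0 < `|h| ^+ 2 + 1 by rewrite ltr_wpDl// sqr_ge0.
(* This is nearly the optimal [t]; the added 1 covers [h = 0]. *)
have := var (- d / (`|h| ^+ 2 + 1)).
rewrite (_ : _ + _ = - d ^+ 2 * (`|h| ^+ 2 + 2) / (`|h| ^+ 2 + 1) ^+ 2); last first.
  by field; rewrite gt_eqF.
rewrite pmulr_lge0 ?invr_gt0 ?exprn_gt0// => hd.
apply/eqP; rewrite -sqrf_eq0 eq_le sqr_ge0 andbT.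
have := sqr_ge0 `|h|; have := sqr_ge0 d; nra.
Unshelve. all: by end_near.
Qed.

End Riesz.

(** * Closed forms *)

Lemma le0_eps {R : realType} (C x : R) :
  (forall e, 0 < e -> x <= C * e) -> x <= 0.
Proof.
move=> h; rewrite leNgt; apply/negP => x0.
have C1 : 0 < `|C| + 1 by rewrite ltr_wpDl.
have := h (x / (`|C| + 1)) (divr_gt0 x0 C1).
rewrite mulrCA ler_pMr// ler_pdivlMr// mul1r.
by have := ler_norm C; lra.
Qed.

Lemma shift_formE {R : realType} {L : hilbertType R} (E : L -> L -> R)
    (a b : R) u v : shift_form E a u v = shift_form E b u v + (a - b) * dotp u v.
Proof. rewrite /shift_form; ring. Qed.

Section ClosedForm.
Context {R : realType} {L : hilbertType R} {E : L -> L -> R} {H : set L}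
  {a0 : R}.
Hypothesis E_closed : closed_form E H a0.
Implicit Types (u v w : L) (a e : R).
Local Notation N := (form_norm E a0).

Lemma domD u v : H u -> H v -> H (u + v).
Proof.
by move=> Hu Hv; rewrite -[u]scale1r; exact: (closed_form_domainP E_closed).
Qed.

Lemma domZ a u : H u -> H (a *: u).
Proof.
move=> Hu; rewrite -[_ *: _]addr0.
exact: (closed_form_domainP E_closed a Hu (closed_form_domain0 E_closed)).
Qed.

Lemma domB u v : H u -> H v -> H (u - v).
Proof. by move=> Hu Hv; apply: domD => //; rewrite -scaleN1r; exact: domZ. Qed.

Lemma shift_formDl a u v w : H u -> H v -> H w ->
  shift_form E a (u + v) w = shift_form E a u w + shift_form E a v w.
Proof.
move=> Hu Hv Hw; rewrite /shift_form -[u in u + v]scale1r.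
rewrite (closed_form_linearl E_closed)// scale1r dotpDl; ring.
Qed.

Lemma shift_form0l a w : H w -> shift_form E a 0 w = 0.
Proof.
have H0 := closed_form_domain0 E_closed.
move=> Hw; apply: (addrI (shift_form E a 0 w)).
by rewrite -shift_formDl// !addr0.
Qed.

Lemma shift_formZl a b u w : H u -> H w ->
  shift_form E a (b *: u) w = b * shift_form E a u w.
Proof.
have H0 := closed_form_domain0 E_closed.
move=> Hu Hw; have := shift_form0l a Hw; rewrite /shift_form.
rewrite dotp0l mulr0 addr0 => E0.
rewrite -[b *: u]addr0 (closed_form_linearl E_closed)// E0 addr0 dotpZl; ring.
Qed.

Lemma shift_formBl a u v w : H u -> H v -> H w ->
  shift_form E a (u - v) w = shift_form E a u w - shift_form E a v w.
Proof.
move=> Hu Hv Hw; have HNv : H (- v) by rewrite -scaleN1r; exact: domZ.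
rewrite shift_formDl//; congr +%R.
by rewrite -scaleN1r shift_formZl// mulN1r.
Qed.

Lemma shift_formDr a u v w : H u -> H v -> H w ->
  shift_form E a w (u + v) = shift_form E a w u + shift_form E a w v.
Proof.
move=> Hu Hv Hw; rewrite /shift_form -[u in u + v]scale1r.
rewrite (closed_form_linearr E_closed)// scale1r dotpDr; ring.
Qed.

Lemma shift_formZr a b u w : H u -> H w ->
  shift_form E a w (b *: u) = b * shift_form E a w u.
Proof.
have H0 := closed_form_domain0 E_closed.
move=> Hu Hw.
have : shift_form E a w 0 = 0.
  by apply: (addrI (shift_form E a w 0)); rewrite -shift_formDr// !addr0.
rewrite /shift_form (dotpC w 0) dotp0l mulr0 addr0 => E0.
rewrite -[b *: u]addr0 (closed_form_linearr E_closed)// E0 addr0 dotpZr; ring.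
Qed.

Lemma shift_formBr a u v w : H u -> H v -> H w ->
  shift_form E a w (u - v) = shift_form E a w u - shift_form E a w v.
Proof.
move=> Hu Hv Hw; have HNv : H (- v) by rewrite -scaleN1r; exact: domZ.
rewrite shift_formDr//; congr +%R.
by rewrite -scaleN1r shift_formZr// mulN1r.
Qed.

Lemma form_coercive a u : H u -> (a - a0) * `|u| ^+ 2 <= shift_form E a u u.
Proof.
move=> /(closed_form_ge0 E_closed).
rewrite /shift_form /symmetric_part -dotp_norm => h; lra.
Qed.

(** A form and its symmetric part agree on the diagonal, which lets the sector condition and the
    resolvent identity speak about the form norm. *)
Lemma form_normE u : N u = Num.sqrt (shift_form E (a0 + 1) u u).
Proof.
congr Num.sqrt; rewrite /shift_form /symmetric_part; lra.
Qed.

Lemma sqr_form_norm u : H u -> N u ^+ 2 = shift_form E (a0 + 1) u u.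
Proof.
move=> Hu; rewrite form_normE sqr_sqrtr// (le_trans _ (form_coercive _ Hu))//.
by rewrite mulr_ge0 ?sqr_ge0// addrC addKr.
Qed.

Lemma form_norm_ge0 u : 0 <= N u. Proof. exact: sqrtr_ge0. Qed.

Lemma norm_le_form_norm u : H u -> `|u| <= N u.
Proof.
move=> Hu; rewrite -(@ler_pXn2r _ 2)// ?nnegrE ?form_norm_ge0//.
rewrite sqr_form_norm// (le_trans _ (form_coercive _ Hu))//.
by rewrite addrC addKr mul1r.
Qed.

Lemma form_norm_parallelogram u v : H u -> H v ->
  N (u - v) ^+ 2 = 2 * N u ^+ 2 + 2 * N v ^+ 2 - 4 * N (2^-1 *: (u + v)) ^+ 2.
Proof.
move=> Hu Hv; have HB := domB Hu Hv; have HD := domD Hu Hv.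
rewrite !sqr_form_norm//; last exact: domZ.
rewrite shift_formBl// !shift_formBr// shift_formZl ?shift_formZr//; last first.
  exact: domZ.
rewrite shift_formDl// !shift_formDr//; lra.
Qed.

(** The sector condition covers the shift [a0 + 1]; any other shift adds a multiple of [dotp], which
    the form norm dominates. *)
Lemma shift_form_bounded a : exists2 K, 0 <= K &
  forall u v, H u -> H v -> `|shift_form E a u v| <= K * N u * N v.
Proof.
have [K K1 hK] := closed_form_sector E_closed.
have K0 : 0 <= K by rewrite (le_trans ler01).
exists (K + `|a - (a0 + 1)|); first by rewrite addr_ge0.
move=> u v Hu Hv; rewrite (shift_formE _ _ (a0 + 1)).
rewrite (le_trans (ler_normD _ _))// -mulrA [leRHS]mulrDl lerD//.
  by rewrite mulrA !form_normE; exact: hK.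
rewrite normrM ler_wpM2l// (le_trans (cauchy_schwarz _ _))//.
by rewrite ler_pM// norm_le_form_norm.
Qed.

Lemma form_cauchy_cvg (p : nat -> L) : (forall n, H (p n)) ->
  (forall e, 0 < e -> exists M, forall m n, (M <= m)%N -> (M <= n)%N ->
     N (p m - p n) ^+ 2 < e) ->
  exists2 u, H u & N (p n - u) @[n --> \oo] --> (0 : R).
Proof.
move=> Hp hp; apply: (closed_form_complete E_closed) => // e e0.
have [M hM] := hp _ (exprn_gt0 2 e0); exists M => m n Mm Mn.
rewrite -(@ltr_pXn2r _ 2)// ?nnegrE ?form_norm_ge0 ?(ltW e0)//.
exact: hM.
Qed.

(* Banach-Saks without weak compactness: among the points of S that are
   L-close to x, almost minimizers of the form norm are Cauchy. *)
Lemma form_bounded_closure (S : set L) (x_ : nat -> L) (x : L) (M : R) :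
  S `<=` H -> (forall y z, S y -> S z -> S (2^-1 *: (y + z))) ->
  (forall n, S (x_ n)) -> (forall n, N (x_ n) <= M) ->
  (forall n, `|x - x_ n| <= n.+1%:R^-1) ->
  H x /\ forall e, 0 < e -> exists2 y, S y & N (y - x) < e.
Proof.
move=> SH Smid Sx xM xx.
pose C n := [set y | S y /\ `|x - y| <= n.+1%:R^-1].
have [||D [Dlow [p Hp]]] :=
    @near_minimizers R L C (fun y => N y ^+ 2) 0 (M ^+ 2).
- by move=> *; exact: sqr_ge0.
- move=> n; exists (x_ n) => //.
  by rewrite ler_pXn2r// nnegrE ?form_norm_ge0// (le_trans (form_norm_ge0 (x_ n))).
have Sp n : S (p n) by have [[]] := Hp n.
have Hp' n : H (p n) by exact: SH.
have [e e0|u Hu pu] := form_cauchy_cvg Hp'.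
  (* The parallelogram identity will give [2 (D + e/9) + 2 (D + e/9) - 4 (D - e/9) = 8e/9]. The
     lower bound applies to the midpoint because it lies in [C K] again. *)
  have e8 : 0 < e / 9 by rewrite divr_gt0.
  have [K hK] := Dlow _ e8; have [K' hK'] := invS_lt e8.
  exists (maxn K K') => m n; rewrite !geq_max => /andP[Km K'm] /andP[Kn K'n].
  have := hK' _ K'm; have := hK' _ K'n.
  have [[Spm xm] pm] := Hp m; have [[Spn xn] pn] := Hp n.
  rewrite form_norm_parallelogram//.
  have : D - e / 9 < N (2^-1 *: (p m + p n)) ^+ 2.
    apply: hK; split; first exact: Smid.
    have -> : x - 2^-1 *: (p m + p n) = 2^-1 *: ((x - p m) + (x - p n)).
      rewrite addrACA -opprD scalerBr; congr (_ - _).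
      by rewrite -mulr2n -(scaler_nat 2 x) scalerA mulVf ?scale1r// pnatr_eq0.
    rewrite normrZ gtr0_norm ?invr_gt0// mulrC ler_pdivrMr//.
    rewrite (le_trans (ler_normD _ _))//.
    have : (m.+1%:R^-1 : R) <= K.+1%:R^-1 by rewrite lef_pV2 ?posrE// ler_nat.
    have : (n.+1%:R^-1 : R) <= K.+1%:R^-1 by rewrite lef_pV2 ?posrE// ler_nat.
    move: xm xn; move: (m.+1%:R^-1) (n.+1%:R^-1) (K.+1%:R^-1) => *; lra.
  move: pm pn; move: (m.+1%:R^-1) (n.+1%:R^-1) => *; lra.
(* The form norm dominates the norm of [L], in which [p] also tends to [x]. *)
have -> : x = u.
  apply/eqP; rewrite -subr_eq0 -normr_le0; apply: (@le0_eps _ 2) => e e0.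
  have [K hK] := invS_lt e0; have [K' hK'] := (cvg0_eps _).1 pu e e0.
  pose m := maxn K K'; have := hK m (leq_maxl _ _); have := hK' m (leq_maxr _ _).
  have [[_ xm] _] := Hp m; rewrite ger0_norm ?form_norm_ge0//.
  have := norm_le_form_norm (domB (Hp' m) Hu).
  have -> : x - u = (x - p m) + (p m - u) by rewrite addrA subrK.
  have := ler_normD (x - p m) (p m - u).
  by move: xm; move: (m.+1%:R^-1) => *; lra.
split=> // e e0; have [K hK] := (cvg0_eps _).1 pu e e0.
by exists (p K) => //; rewrite -[N _]ger0_norm ?form_norm_ge0// hK.
Qed.

End ClosedForm.

(** * Resolvents and adjoint resolvents *)

Section Resolvent.
Context {R : realType} {L : hilbertType R} {E : L -> L -> R} {H : set L}
  {a0 : R} {G : R -> L -> L}.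
Hypotheses (E_closed : closed_form E H a0) (G_res : resolvent_of E H a0 G).
Implicit Types (u v w f g : L) (a e : R).
Local Notation N := (form_norm E a0).

Let HG a f : a0 < a -> H (G a f).
Proof. exact: (resolvent_domain G_res). Qed.

Lemma resolventD a f g : a0 < a -> G a (f + g) = G a f + G a g.
Proof.
by move=> /(resolvent_linear G_res)/(_ 1 f g); rewrite !scale1r.
Qed.

Lemma resolventZ a b f : a0 < a -> G a (b *: f) = b *: G a f.
Proof.
move=> aa; have lin := resolvent_linear G_res aa.
have G0 : G a 0 = 0.
  by apply: (addrI (G a 0)); rewrite -resolventD// !addr0.
by rewrite -[b *: f]addr0 lin G0 addr0.
Qed.

Lemma resolventB a f g : a0 < a -> G a (f - g) = G a f - G a g.
Proof.
by move=> aa; rewrite resolventD// -scaleN1r resolventZ// scaleN1r.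
Qed.

Lemma resolvent_le a f : a0 < a -> `|G a f| <= (a - a0)^-1 * `|f|.
Proof.
move=> aa; have := resolvent_contraction G_res f aa.
have a_gt0 : 0 < a - a0 by rewrite subr_gt0.
by rewrite normrZ gtr0_norm// ler_pdivlMl.
Qed.

(* The approximations [l *: G l u] of [u] stay bounded in the form norm. *)
Lemma resolvent_bounded_closure a u (M : R) : a0 < a -> 0 <= M ->
  (forall g, dotp g u <= M * N (G a g)) ->
  H u /\ forall e, 0 < e -> exists g, N (G a g - u) < e.
Proof.
move=> aa M0 Mu.
pose C := M + `|a| + `|a0 + 1 - a| * (`|u| + 1).
have approx n : exists x, [/\ (exists g, x = G a g), N x <= C
    & `|u - x| <= n.+1%:R^-1].
  have n0 : 0 < n.+1%:R^-1 :> R by rewrite invr_gt0.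
  have /cvgrPdist_lt/(_ _ n0)[A [_ hA]] := resolvent_continuous G_res (f := u).
  pose l := `|A| + `|a0| + 1; pose w := l *: G l u.
  have Al : A < l by rewrite /l; have := ler_norm A; have := normr_ge0 a0; lra.
  have l_gt0 : 0 < l by rewrite /l; have := normr_ge0 A; have := normr_ge0 a0; lra.
  have a0l : a0 < l by rewrite /l; have := ler_norm a0; have := normr_ge0 A; lra.
  have uw : `|u - w| < n.+1%:R^-1 by exact: hA.
  have uw1 : `|u - w| <= 1.
    by rewrite (le_trans (ltW uw))// invf_le1// ler1n.
  (* By the resolvent equation this is the preimage of [w = l *: G l u] under [G a]. *)
  pose g := l *: u - (l - a) *: w.
  have wE : w = G a g.
    rewrite /g resolventB// !resolventZ//.
    have : G a u - G l u = (l - a) *: G a (G l u).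
      exact: (resolvent_equation G_res).
    move=> /(canRL (subrK _)) ->.
    by rewrite scalerDr !scalerA mulrC addrAC subrr add0r.
  clearbody w; have Hw : H w by rewrite wE; exact: HG.
  exists w; split; [by exists g| |exact: ltW].
  have wu : `|w| <= `|u| + 1.
    have -> : w = u - (u - w) by rewrite opprB addrC subrK.
    by rewrite (le_trans (ler_normB _ _))// lerD2l.
  have wN := norm_le_form_norm E_closed Hw.
  have N0 := form_norm_ge0 (E := E) (a0 := a0) w.
  have := sqr_form_norm E_closed Hw.
  rewrite (shift_formE _ _ a) {2}wE (resolvent_form G_res)// => NE.
  have := Mu g; rewrite -wE => gu.
  have wuw := dotp_le w (w - u).
  have {}wuw : - (a * dotp w (u - w)) <= `|a| * N w.
    rewrite (le_trans (ler_norm _))// normrN normrM ler_wpM2l//.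
    rewrite (le_trans (cauchy_schwarz _ _))// -[leRHS]mulr1.
    by rewrite ler_pM.
  have ww : (a0 + 1 - a) * dotp w w <= `|a0 + 1 - a| * (`|u| + 1) * N w.
    rewrite (le_trans (ler_norm _))// normrM -mulrA ler_wpM2l//.
    by rewrite (le_trans (cauchy_schwarz _ _))// ler_pM.
  (* Since [g = l (u - w) + a w], the only term growing with [l] has a negative sign. Dropping it
     leaves multiples of [N w], and dividing by [N w] gives the bound [C], independent of [l]. *)
  have gw : dotp g w = dotp g u - l * `|u - w| ^+ 2 - a * dotp w (u - w).
    rewrite sqr_normB -!dotp_norm /g !dotpBl !dotpBr !dotpZl (dotpC w u); ring.
  have lu : 0 <= l * `|u - w| ^+ 2 by rewrite mulr_ge0 ?(ltW l_gt0)// sqr_ge0.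
  have [->|Nw0] := eqVneq (N w) 0; first by rewrite !addr_ge0// mulr_ge0// addr_ge0.
  have {Nw0}N0 : 0 < N w by rewrite lt_neqAle eq_sym Nw0.
  rewrite -(ler_pM2r N0) -expr2 NE gw /C; lra.
have /choice[x_ hx] := approx.
have [||n|n|n|Hu uS] := @form_bounded_closure _ _ _ _ _ E_closed
    (range (G a)) x_ u C.
- by move=> _ [g _ <-]; exact: HG.
- move=> _ _ [g _ <-] [h _ <-]; exists (2^-1 *: (g + h)) => //.
  by rewrite resolventZ// resolventD.
- by have [[g ->]] := hx n; exists g.
- by have [] := hx n.
- by have [] := hx n.
split=> // e /uS[_ [g _ <-] ?]; by exists g.
Qed.

(** For [v] in [H], [dotp g v = E_a (G a g, v)] is at most [K * N v * N (G a g)], so the preceding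
    closure lemma applies to [v] itself. *)
Lemma resolvent_dense a v e : a0 < a -> H v -> 0 < e ->
  exists g, N (G a g - v) < e.
Proof.
move=> aa Hv e0; have [K K0 hK] := shift_form_bounded E_closed a.
have [||_] := @resolvent_bounded_closure a v (K * N v) aa; last exact.
  by rewrite mulr_ge0// form_norm_ge0.
move=> g; rewrite -(resolvent_form G_res _ aa)//.
by rewrite (le_trans (ler_norm _))// mulrAC hK//; exact: HG.
Qed.

(** [u] represents the functional sending [g] to [dotp (G a g) f]. This functional is at most
    [|f| * N (G a g)], which puts [u] in [H]; the equation then holds on the range of [G a] and
    extends to [H] by density. *)
Lemma adjoint_exists a f : a0 < a ->
  exists2 u, H u & forall v, H v -> shift_form E a v u = dotp v f.
Proof.
move=> aa.
have a_gt0 : 0 <= (a - a0)^-1 by rewrite invr_ge0 subr_ge0 ltW.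
have [||u hu] := @riesz R L (fun g => dotp (G a g) f) ((a - a0)^-1 * `|f|).
- by move=> b g h; rewrite resolventD// resolventZ// dotpDl dotpZl.
- move=> g; rewrite (le_trans (dotp_le _ _))// mulrAC ler_wpM2r//.
  exact: resolvent_le.
have [//||Hu _] := @resolvent_bounded_closure a u `|f| aa.
  move=> g; rewrite -hu (le_trans (dotp_le _ _))// mulrC ler_wpM2l//.
  by apply: (norm_le_form_norm E_closed); exact: HG.
exists u => // v Hv; have [K K0 hK] := shift_form_bounded E_closed a.
apply/eqP; rewrite -subr_eq0 -normr_le0.
apply: (@le0_eps _ (K * N u + `|f|)) => e e0.
have [g gv] := resolvent_dense aa Hv e0.
have HGg := HG g aa.
have HB := domB E_closed HGg Hv.
have -> : shift_form E a v u - dotp v f =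
    dotp (G a g - v) f - shift_form E a (G a g - v) u.
  rewrite dotpBl (shift_formBl E_closed)// (resolvent_form G_res)// hu; ring.
rewrite (le_trans (ler_normB _ _))// addrC mulrDl lerD//.
  rewrite (le_trans (hK _ _ _ _))// mulrAC ler_wpM2l ?mulr_ge0 ?form_norm_ge0//.
  exact: ltW.
rewrite (le_trans (cauchy_schwarz _ _))// mulrC ler_wpM2l//.
by rewrite (le_trans (norm_le_form_norm E_closed HB))// ltW.
Qed.

(** Coercivity tested at [v = u]. The constant is free of the sector constant, hence uniform over a
    sequence of forms. *)
Lemma adjoint_le a f u : a0 < a -> H u ->
  (forall v, H v -> shift_form E a v u = dotp v f) ->
  `|u| <= (a - a0)^-1 * `|f|.
Proof.
move=> aa Hu hu; have a_gt0 : 0 < a - a0 by rewrite subr_gt0.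
rewrite ler_pdivlMl//.
have [->|u0] := eqVneq u 0; first by rewrite normr0 mulr0.
rewrite -(@ler_pM2r _ `|u|) ?normr_gt0// -mulrA -expr2.
rewrite (le_trans (form_coercive E_closed a Hu))// hu// mulrC.
exact: dotp_le.
Qed.

Lemma adjoint_uniq a f u u' : a0 < a -> H u -> H u' ->
  (forall v, H v -> shift_form E a v u = dotp v f) ->
  (forall v, H v -> shift_form E a v u' = dotp v f) -> u = u'.
Proof.
move=> aa Hu Hu' hu hu'; apply/eqP; rewrite -subr_eq0 -normr_le0.
have HB := domB E_closed Hu Hu'.
rewrite (le_trans (adjoint_le (f := 0) aa HB _)) ?normr0 ?mulr0// => v Hv.
by rewrite (shift_formBr E_closed)// hu// hu'// subrr dotpC dotp0l.
Qed.

(** Homogeneity turns the supremum over the unit sphere of [H] into an inequality on all of [H]; a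
    vector of form norm 0 is 0. *)
Lemma Theta_leP u (M : R) : 0 <= M -> H u ->
  (Theta E H a0 u <= M%:E)%E <->
  forall v, H v -> shift_form E (a0 + 1) v u <= M * N v.
Proof.
move=> M0 Hu; split=> [TM v Hv|h]; last first.
  apply: ge_ereal_sup => _ [v [Hv Nv] <-].
  by have := h v Hv; rewrite Nv mulr1 lee_fin.
have [Nv0|Nv0] := eqVneq (N v) 0.
  have /eqP : `|v| = 0.
    by apply/eqP; rewrite eq_le normr_ge0 andbT -Nv0 (norm_le_form_norm E_closed).
  by rewrite normr_eq0 => /eqP ->; rewrite (shift_form0l E_closed)//
    mulr_ge0// form_norm_ge0.
have N0 : 0 < N v by rewrite lt_neqAle eq_sym Nv0 form_norm_ge0.
have HV : H ((N v)^-1 *: v) by exact: (domZ E_closed).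
have : ((shift_form E (a0 + 1) ((N v)^-1 *: v) u)%:E <= M%:E)%E.
  rewrite (le_trans _ TM)//; apply: ereal_sup_ubound.
  exists ((N v)^-1 *: v) => //; split => //; apply/eqP.
  rewrite -(@eqrXn2 _ 2)// ?form_norm_ge0// (sqr_form_norm E_closed)//.
  rewrite (shift_formZl E_closed)// (shift_formZr E_closed)//.
  by rewrite -(sqr_form_norm E_closed)// mulrA -expr2 exprVn mulVf ?expr1n// expf_neq0.
by rewrite (shift_formZl E_closed)// lee_fin ler_pdivrMl// mulrC.
Qed.

End Resolvent.

(** * Strong and weak convergence along varying spaces *)

Lemma cvg_eq {R : realType} (l l' : R) (x : nat -> R) :
  l = l' -> x n @[n --> \oo] --> l -> x n @[n --> \oo] --> l'.
Proof. by move=> ->. Qed.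

Lemma cvg_le_eps {R : realType} (C l : R) (x : nat -> R) :
  (forall e, 0 < e -> \forall n \near \oo, `|l - x n| <= C * e) ->
  x n @[n --> \oo] --> l.
Proof.
move=> h; apply/cvgrPdist_le => e e0.
have C1 : 0 < `|C| + 1 by rewrite ltr_wpDl.
have := h _ (divr_gt0 e0 C1); apply: filterS => n /le_trans; apply.
rewrite mulrCA ger_pMr// ler_pdivrMr// mul1r.
by have := ler_norm C; lra.
Qed.

Lemma cvg_norm_le {R : realType} (l : R) (x y : nat -> R) :
  (forall n, `|l - x n| <= y n) -> y n @[n --> \oo] --> (0 : R) ->
  x n @[n --> \oo] --> l.
Proof.
move=> xy /cvgrPdist_le y0; apply/cvgrPdist_le => e /y0; apply: filterS => n.
rewrite sub0r normrN; apply: le_trans; rewrite (le_trans (xy n))//.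
exact: ler_norm.
Qed.

(** * Extraction and gluing of subsequences *)

Lemma homo_ltn_cvgy (n_ : nat -> nat) : {homo n_ : i j / (i < j)%N} ->
  n_ k @[k --> \oo] --> \oo.
Proof.
move=> inc; have le k : (k <= n_ k)%N.
  by elim: k => // k IH; rewrite (leq_ltn_trans IH)// inc.
move=> A [N _ NA]; exists N => // k /= Nk; apply: NA => /=.
exact: leq_trans (le k).
Qed.

Lemma increasing_choice (P : nat -> nat -> Prop) :
  (forall k N, exists2 n, (N <= n)%N & P k n) ->
  exists2 n_ : nat -> nat, {homo n_ : i j / (i < j)%N} & forall k, P k (n_ k).
Proof.
move=> h; have /choice[f hf] : forall kN : nat * nat, exists n,
  (kN.2 <= n)%N /\ P kN.1 n.
  by move=> [k N]; have [n] := h k N; exists n.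
pose n_ := fix n_ k := match k with
  | 0%N => f (0%N, 0%N) | k'.+1 => f (k'.+1, (n_ k').+1) end.
exists n_; last first.
  by case=> [|k]; [have [] := hf (0%N, 0%N)|have [] := hf (k.+1, (n_ k).+1)].
by apply: homo_ltn => [|k]; [exact: ltn_trans|have [] := hf (k.+1, (n_ k).+1)].
Qed.

Lemma glue_subsequence (T : nat -> Type) (n_ : nat -> nat) :
  {homo n_ : i j / (i < j)%N} ->
  forall (u : forall k, T (n_ k)) (d : forall n, T n),
  exists w : forall n, T n, (forall k, w (n_ k) = u k) /\
    (forall n, (forall k, n_ k <> n) -> w n = d n).
Proof.
move=> inc u d.
have inj : injective n_.
  by move=> i j e; case: (ltngtP i j) => // /inc; rewrite e ltnn.
(* The value [u k] lives in [T (n_ k)] and must be transported to [T n]. Quantifying over all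
   equality proofs lets [erefl] recover [w (n_ k) = u k]; injectivity of [n_] and proof irrelevance
   make this consistent. *)
pose Q n (x : T n) := (forall k (e : n_ k = n), x = eq_rect _ T (u k) _ e) /\
  ((forall k, n_ k <> n) -> x = d n).
have hw n : exists x, Q n x.
  have [[k e]|nk] := pselect (exists k, n_ k = n).
    exists (eq_rect _ T (u k) _ e); split=> [k' e'|/(_ k e)//].
    have kk' : k' = k by apply: inj; rewrite e e'.
    by subst k'; congr eq_rect; exact: Prop_irrelevance.
  exists (d n); split=> // k e; case: nk; by exists k.
exists (fun n => projT1 (cid (hw n))); split=> [k|n nk].
  by case: cid => x [/= /(_ k erefl)].
by case: cid => x [/= _ /(_ nk)].
Qed.

Section VaryingSpaces.
Context {R : realType} {L : hilbertType R} {Ln : nat -> hilbertType R}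
  {Phi : forall n, {linear L -> Ln n}}.
Hypothesis Phi_norm : forall u : L, `|Phi n u| @[n --> \oo] --> `|u|.

Lemma subsequence_Phi_norm (n_ : nat -> nat) : {homo n_ : i j / (i < j)%N} ->
  forall u : L, `|Phi (n_ k) u| @[k --> \oo] --> `|u|.
Proof.
move=> inc u; exact: (cvg_comp n_ (fun n => `|Phi n u|) (homo_ltn_cvgy inc) (@Phi_norm u)).
Qed.

Lemma subsequence_strongly_cvg (n_ : nat -> nat) u_ u :
  {homo n_ : i j / (i < j)%N} -> strongly_cvg Phi u_ u ->
  @strongly_cvg R L (fun k => Ln (n_ k)) (fun k => Phi (n_ k))
    (fun k => u_ (n_ k)) u.
Proof.
move=> inc uu.
exact: (cvg_comp n_ (fun n => `|Phi n u - u_ n|) (homo_ltn_cvgy inc) uu).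
Qed.

Lemma Phi_strongly_cvg u : strongly_cvg Phi (fun n => Phi n u) u.
Proof.
apply: (@cvg_norm_le _ _ _ (fun=> 0)); last exact: cvg_cst.
by move=> n; rewrite subrr normr0 subrr normr0.
Qed.

(** Polarization, with the norm hypothesis applied to [u], [v] and [u - v]. *)
Lemma Phi_dotp_cvg u v : dotp (Phi n u) (Phi n v) @[n --> \oo] --> dotp u v.
Proof.
have polar (V : hilbertType R) (x y : V) :
    dotp x y = 2^-1 * (`|x| * `|x| + `|y| * `|y| - `|x - y| * `|x - y|).
  by have := sqr_normB x y; rewrite !expr2 => h; lra.
rewrite polar.
under eq_fun do rewrite polar -raddfB.
apply: cvgMr; apply: cvgB; first apply: cvgD; apply: cvgM; exact: Phi_norm.
Qed.

Lemma strongly_weakly_cvg u_ u : strongly_cvg Phi u_ u -> weakly_cvg Phi u_ u.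
Proof.
move=> uu v_ v vv.
have -> : (fun n => dotp (u_ n) (v_ n)) = (fun n => dotp (Phi n u) (Phi n v) -
    (dotp (Phi n u - u_ n) (v_ n) + dotp (Phi n u) (Phi n v - v_ n))).
  by apply/funext => n; rewrite dotpBl dotpBr; ring.
rewrite -[dotp u v]subr0; apply: cvgB; first exact: Phi_dotp_cvg.
apply: (@cvg_norm_le _ _ _ (fun n => `|Phi n u - u_ n| *
  (`|Phi n v| + `|Phi n v - v_ n|) + `|Phi n u| * `|Phi n v - v_ n|)).
  move=> n; rewrite sub0r normrN (le_trans (ler_normD _ _))// lerD//.
    rewrite (le_trans (cauchy_schwarz _ _))// ler_wpM2l//.
    by rewrite -{1}(subKr (Phi n v) (v_ n)) ler_normB.
  exact: cauchy_schwarz.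
apply: (@cvg_eq _ (0 * (`|v| + 0) + `|u| * 0)); first by ring.
apply: cvgD; apply: cvgM => //.
exact: cvgD.
Qed.

(** In the expansion of [|Phi n u - u_ n|^2] the cross term converges by weak convergence tested
    against [Phi n u]. *)
Lemma weakly_strongly_cvg u_ u : weakly_cvg Phi u_ u ->
  dotp (u_ n) (u_ n) @[n --> \oo] --> dotp u u -> strongly_cvg Phi u_ u.
Proof.
move=> uu nu; rewrite /strongly_cvg.
have : `|Phi n u - u_ n| ^+ 2 @[n --> \oo] --> (0 : R).
  under eq_fun => n.
    rewrite sqr_normB -!dotp_norm [dotp (Phi n u) (u_ n)]dotpC; over.
  apply: (@cvg_eq _ (dotp u u - 2 * dotp u u + dotp u u)); first by ring.
  apply: cvgD => //; apply: cvgB; first exact: Phi_dotp_cvg.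
  by apply: cvgMr; apply: uu; exact: Phi_strongly_cvg.
move=> /cvg0_eps h; apply/cvg0_eps => e e0.
have [N hN] := h _ (exprn_gt0 2 e0); exists N => n /hN.
by rewrite ger0_norm ?sqr_ge0// ltr_pXn2r ?nnegrE ?(ltW e0)// normr_id.
Qed.

Lemma strongly_bounded u_ u : strongly_cvg Phi u_ u ->
  exists M, forall n, `|u_ n| <= M.
Proof.
move=> uu; have : `|Phi n u| + `|Phi n u - u_ n| @[n --> \oo] --> `|u| + 0.
  exact: cvgD.
move=> /cvgP/cvg_seq_bounded[M [_ hM]]; exists (M + 1) => n.
have := hM (M + 1); rewrite ltrDl ltr01 => /(_ isT n I) /=.
apply: le_trans; rewrite (le_trans _ (ler_norm _))//.
by rewrite -{1}(subKr (Phi n u) (u_ n)) ler_normB.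
Qed.

Lemma weakly_cvg_dense (D : set L) u_ u (M : R) : dense D ->
  (forall n, `|u_ n| <= M) ->
  (forall d, D d -> dotp (u_ n) (Phi n d) @[n --> \oo] --> dotp u d) ->
  weakly_cvg Phi u_ u.
Proof.
move=> denseD uM uD v_ v vv; have M0 : 0 <= M := le_trans (normr_ge0 _) (uM 0%N).
(* The summands bound, in order, the errors from replacing [v_ n] by [Phi n v], from replacing [v]
   by [d] (where [|Phi n (v - d)| <= 2e] eventually), from the convergence tested at [d], and from
   [dotp u (v - d)]. *)
apply: (@cvg_le_eps _ (M + 2 * M + 1 + `|u|)) => e e0.
have [|d [ved Dd]] := denseD (ball v e) _ (ball_open _ _).
  by exists v; exact: ballxx.
move: ved; rewrite -ball_normE /= => ved.
have /cvgrPdist_le/(_ _ e0) ud := uD d Dd.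
have /cvgrPdist_le/(_ _ e0) Pd := @Phi_norm (v - d).
have /cvgrPdist_le/(_ _ e0) := vv.
apply: filterS3 ud Pd => n ud Pd; rewrite sub0r normrN normr_id => vn.
have -> : dotp u v - dotp (u_ n) (v_ n) = dotp (u_ n) (Phi n v - v_ n)
   - dotp (u_ n) (Phi n (v - d)) + (dotp u d - dotp (u_ n) (Phi n d))
   + dotp u (v - d).
  by rewrite raddfB !dotpBr; ring.
rewrite (le_trans (ler_normD _ _))// [leRHS]mulrDl lerD//; last first.
  by rewrite (le_trans (cauchy_schwarz _ _))// ler_wpM2l// ltW.
rewrite (le_trans (ler_normD _ _))// [leRHS]mulrDl mul1r lerD//.
rewrite (le_trans (ler_normB _ _))// [leRHS]mulrDl lerD//.
  by rewrite (le_trans (cauchy_schwarz _ _))// ler_pM.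
rewrite (le_trans (cauchy_schwarz _ _))// (mulrC 2) -mulrA ler_pM//.
move: Pd; rewrite distrC => /(le_trans (ler_norm _)) Pd; lra.
Qed.

End VaryingSpaces.

(** * Ultrafilter limits and weak sequential compactness *)

Lemma fmap_ultra {T V : Type} (f : T -> V) (F : set_system T) :
  UltraFilter F -> UltraFilter (f @ F).
Proof.
move=> FU; split=> [|G GF FG]; first exact: fmap_proper_filter.
rewrite eqEsubset; split=> // A GA.
have [//|FnA] := in_ultra_setVsetC (f @^-1` A) FU.
have /FG GnA : (f @ F) (~` A) by [].
by have [y []] := filter_ex (filterI GA GnA).
Qed.

Section WeakCompactness.
Context {R : realType} {L : hilbertType R} {Ln : nat -> hilbertType R}
  {Phi : forall n, {linear L -> Ln n}}.
Hypothesis Phi_norm : forall u : L, `|Phi n u| @[n --> \oo] --> `|u|.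

(* Limits along an ultrafilter on nat give a bounded linear functional, hence
   the candidate weak limit; a countable dense set then yields the
   subsequence. *)
Lemma weakly_cvg_subsequence (u_ : forall n, Ln n) (M : R) : separable L ->
  (forall n, `|u_ n| <= M) ->
  exists2 n_ : nat -> nat, {homo n_ : i j / (i < j)%N} &
  exists u, @weakly_cvg R L (fun k => Ln (n_ k)) (fun k => Phi (n_ k))
    (fun k => u_ (n_ k)) u.
Proof.
move=> [D /countable_injP[f finj] denseD] uM.
have M0 : 0 <= M := le_trans (normr_ge0 _) (uM 0%N).
have [U [UU ooU]] := @ultraFilterLemma _ \oo _.
pose x v n := dotp (u_ n) (Phi n v).
have xM v n : `|x v n| <= M * `|Phi n v|.
  by rewrite (le_trans (cauchy_schwarz _ _))// ler_wpM2r.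
have /choice[l xl] : forall v : L, exists l : R, x v n @[n --> U] --> l.
  move=> v; pose A := M * (`|v| + 1).
  have := @segment_compact R (- A) A; rewrite compact_ultra.
  move=> /(_ (x v @ U) (fmap_ultra _ UU)) cpt.
  suff /cpt[l [_ xl]] : (x v @ U) `[- A, A]%classic by exists l.
  apply: (ooU (x v @^-1` `[- A, A])); have /cvgrPdist_le/(_ _ ltr01) := @Phi_norm v.
  apply: filterS => n Pv; rewrite /= in_itv /= -ler_norml (le_trans (xM v n))//.
  rewrite ler_wpM2l// -lerBlDl (le_trans _ Pv)// distrC; exact: ler_norm.
have [||u lu] := @riesz R L l M.
- move=> a v w; apply: (@cvg_unique _ _ (x (a *: v + w) @ U)).
  + exact: norm_hausdorff.
  + exact: xl.
  + have -> : x (a *: v + w) = (fun n => a * x v n + x w n).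
      by apply/funext => n; rewrite /x linearP dotpDr dotpZr.
    by apply: cvgD; [apply: cvgMr|]; exact: xl.
- move=> v; apply: (ler_cvg_to (xl v) (g := fun n => M * `|Phi n v|)).
    apply: cvg_trans (cvgMr (@Phi_norm v)); exact: cvg_app.
  by apply: nearW => n; exact: le_trans (ler_norm _) (xM v n).
(* [d] inverts the injection [f] and so enumerates [D]; outside the image of [f] any value will
   do. *)
have /choice[d hd] : forall j, exists y, forall z, D z -> f z = j -> y = z.
  move=> j; have [[y [Dy fy]]|nD] := pselect (exists y, D y /\ f y = j).
    by exists y => z Dz fz; apply: finj; rewrite ?inE// fy fz.
  by exists 0 => z Dz fz; case: nD; exists z.
(* Finitely many test vectors are handled at each index, and [U] contains all tails, so the diagonal
   subsequence is chosen in one pass. *)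
have [|n_ inc hn] := @increasing_choice (fun k n =>
    forall j : 'I_k.+1, `|l (d j) - x (d j) n| < k.+1%:R^-1).
  move=> k N.
  have : \forall n \near U, forall j : 'I_k.+1,
      `|l (d j) - x (d j) n| < k.+1%:R^-1.
    apply: filter_forall => j; have /cvgrPdist_lt := @xl (d j); apply.
    by rewrite invr_gt0.
  have : \forall n \near U, (N <= n)%N by apply: (ooU [set n | (N <= n)%N]); exists N.
  move=> h1 h2; have [n [Nn hn]] := filter_ex (filterI h1 h2).
  by exists n.
exists n_ => //; exists u.
apply: (@weakly_cvg_dense _ _ (fun k => Ln (n_ k)) (fun k => Phi (n_ k))
   (@subsequence_Phi_norm _ _ _ _ Phi_norm _ inc) D _ _ M denseD) => // v Dv.
have dv : d (f v) = v by exact: hd.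
apply: (@cvg_le_eps _ 1) => e e0.
have [K hK] := invS_lt e0; exists (maxn K (f v)) => // k /=.
rewrite geq_max => /andP[Kk fk]; rewrite mul1r.
have fk' : (f v < k.+1)%N by rewrite ltnS.
have := hn k (Ordinal fk'); rewrite /= dv lu (dotpC v u) => /ltW /le_trans; apply.
exact/ltW/hK.
Qed.

End WeakCompactness.

(** * Mosco convergence *)

(** The liminf is the supremum of the tail infima, so its being below [+oo] means a bound met
    infinitely often. *)
Lemma limn_einf_lty {R : realType} (u : nat -> \bar R) :
  (limn_einf u < +oo)%E <->
  exists2 M : R, 0 <= M & forall N, exists2 n, (N <= n)%N & (u n <= M%:E)%E.
Proof.
have -> : limn_einf u = ereal_sup (range (einfs u)).
  by rewrite limn_einf_lim; apply/cvg_lim => //; exact: cvg_einfs_sup.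
split=> [uy|[M M0 uM]]; last first.
  apply: (@le_lt_trans _ _ M%:E); last exact: ltry.
  apply: ge_ereal_sup => _ [N _ <-]; have [n Nn un] := uM N.
  by apply: ge_ereal_inf; exists (u n) => //; exists n.
have [M M0 uM] : exists2 M : R, 0 <= M & (ereal_sup (range (einfs u)) < M%:E)%E.
  move: uy; case: (ereal_sup _) => [r _|//|_]; last by exists 0 => //; exact: ltNyr.
  exists (`|r| + 1); first by rewrite addr_ge0.
  by rewrite lte_fin (le_lt_trans (ler_norm r))// ltrDl.
exists M => // N; have : (einfs u N < M%:E)%E.
  by apply: le_lt_trans uM; apply: ereal_sup_ubound; exists N.
by move=> /ereal_inf_lt[_ [n Nn <-] /ltW]; exists n.
Qed.

Lemma cvg_le_frequently {R : realType} (x y : nat -> R) (l l' : R) :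
  x n @[n --> \oo] --> l -> y n @[n --> \oo] --> l' ->
  (forall N, exists2 n, (N <= n)%N & x n <= y n) -> l <= l'.
Proof.
move=> xl yl xy; rewrite leNgt; apply/negP => ll'.
have /cvgr_gt/(_ 0) : x n - y n @[n --> \oo] --> l - l' by exact: cvgB.
rewrite subr_gt0 => /(_ ll')[N _ hN]; have [n Nn] := xy N.
by apply/negP; rewrite -ltNge -subr_gt0; exact: hN.
Qed.

Lemma cvg_glue {R : realType} (n_ : nat -> nat) (x y : nat -> R) (l : R) :
  {homo n_ : i j / (i < j)%N} ->
  (forall n, (forall k, n_ k <> n) -> x n = y n) ->
  x (n_ k) @[k --> \oo] --> l -> y n @[n --> \oo] --> l ->
  x n @[n --> \oo] --> l.
Proof.
move=> inc xy /cvgrPdist_lt xl /cvgrPdist_lt yl; apply/cvgrPdist_lt => e e0.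
have [K _ hK] := xl e e0; have [N _ hN] := yl e e0.
exists (maxn (n_ K) N) => // n /=; rewrite geq_max => /andP[Kn Nn].
have [[k nk]|nk] := pselect (exists k, n_ k = n); last first.
  by rewrite xy => [|k e']; [exact: hN|case: nk; exists k].
subst n; apply: hK => /=; rewrite leqNgt; apply/negP => /inc.
by rewrite ltnNge Kn.
Qed.

(* The near-minimizers of err n over P n converge as soon as the infima do, so
   no diagonal extraction is needed. *)
Lemma cvg0_choice {R : realType} (T : nat -> Type) (P : forall n, set (T n))
    (err : forall n, T n -> R) (C : R) :
  (forall n, P n !=set0) -> (forall n x, 0 <= err n x) ->
  (forall e, 0 < e ->
    \forall n \near \oo, exists2 x, P n x & err n x <= C * e) ->
  exists x_ : forall n, T n, (forall n, P n (x_ n)) /\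
    err n (x_ n) @[n --> \oo] --> (0 : R).
Proof.
move=> P0 err0 herr.
have near_inf n : exists x, P n x /\
    forall y, P n y -> err n x <= err n y + n.+1%:R^-1.
  have hinf : has_inf (err n @` P n).
    split; first by have [x Px] := P0 n; exists (err n x), x.
    by exists 0 => _ [x _ <-].
  have n0 : (0 : R) < n.+1%:R^-1 by rewrite invr_gt0.
  have [_ [x Px <-] hx] := inf_adherent n0 hinf.
  exists x; split=> // y Py; rewrite (le_trans (ltW hx))// lerD2r.
  by apply: ge_inf; [exact: hinf.2|exists y].
exists (fun n => projT1 (cid (near_inf n))); split.
  by move=> n; case: cid => x [].
apply: (@cvg_le_eps _ (C + 1)) => e e0; have [N hN] := invS_lt e0.
have := herr e e0; have : \forall n \near \oo, (N <= n)%N by exists N.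
apply: filterS2 => n /hN ne [y Py ye]; case: cid => x /= [Px /(_ y Py) xy].
rewrite sub0r normrN ger0_norm// mulrDl mul1r (le_trans xy)// lerD//.
exact: ltW.
Qed.

Section Mosco.
Context {R : realType} {L : hilbertType R} {Ln : nat -> hilbertType R}
  {Phi : forall n, {linear L -> Ln n}} {a0 : R} {E : L -> L -> R} {H : set L}
  {En : forall n, Ln n -> Ln n -> R} {Hn : forall n, set (Ln n)}
  {G : R -> L -> L} {Gn : forall n, R -> Ln n -> Ln n}.
Arguments En : clear implicits.
Arguments Hn : clear implicits.
Arguments Gn : clear implicits.
Hypotheses (L_sep : separable L)
  (Phi_norm : forall u : L, `|Phi n u| @[n --> \oo] --> `|u|)
  (E_closed : closed_form E H a0)
  (En_closed : forall n, closed_form (En n) (Hn n) a0)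
  (G_res : resolvent_of E H a0 G)
  (Gn_res : forall n, resolvent_of (En n) (Hn n) a0 (Gn n)).

(** (F1) and (F2) speak of full sequences. The gaps are filled with domain elements within [1/(n+1)]
    of [Phi n u], found by density of [Hn n]; they converge strongly to [u]. *)
Lemma extend_subsequence (n_ : nat -> nat) (u_ : forall k, Ln (n_ k)) u :
  {homo n_ : i j / (i < j)%N} -> (forall k, Hn (n_ k) (u_ k)) ->
  @weakly_cvg R L (fun k => Ln (n_ k)) (fun k => Phi (n_ k)) u_ u ->
  exists w : forall n, Ln n, [/\ forall n, Hn n (w n),
    forall k, w (n_ k) = u_ k & weakly_cvg Phi w u].
Proof.
move=> inc Hu uu.
have near_dense n : exists x, Hn n x /\ `|Phi n u - x| < n.+1%:R^-1.
  have n0 : (0 : R) < n.+1%:R^-1 by rewrite invr_gt0.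
  have [|x [Bx Hx]] := closed_form_dense (En_closed n)
      (O := ball (Phi n u) n.+1%:R^-1) _ (ball_open _ _).
    by exists (Phi n u); exact: ballxx.
  by exists x; split => //; move: Bx; rewrite -ball_normE.
pose d n := projT1 (cid (near_dense n)).
have Hd n : Hn n (d n) by rewrite /d; case: cid => x [].
have du : strongly_cvg Phi d u.
  apply: (@cvg_norm_le _ _ _ (fun n => n.+1%:R^-1)); last exact: cvg_harmonic.
  by move=> n; rewrite sub0r normrN normr_id /d; case: cid => x /= [_ /ltW].
have [w [wu wd]] := @glue_subsequence Ln n_ inc u_ d.
exists w; split=> // [n|v_ v vv].
  have [[k <-]|nk] := pselect (exists k, n_ k = n); first by rewrite wu.
  by rewrite wd// => k e; apply: nk; exists k.
apply: (@cvg_glue _ n_ _ (fun n => dotp (d n) (v_ n))) => //.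
- by move=> n /wd ->.
- under eq_fun do rewrite wu.
  by apply: (uu (fun k => v_ (n_ k))); exact: subsequence_strongly_cvg.
- exact: (strongly_weakly_cvg Phi_norm).
Qed.

(** Test sequences along [n_] are not restrictions of given full ones, so boundedness is used to
    reduce to the test vectors [Phi (n_ k) d]. *)
Lemma subsequence_weakly_cvg (n_ : nat -> nat) h_ h (M : R) :
  {homo n_ : i j / (i < j)%N} -> (forall n, `|h_ n| <= M) ->
  weakly_cvg Phi h_ h ->
  @weakly_cvg R L (fun k => Ln (n_ k)) (fun k => Phi (n_ k))
    (fun k => h_ (n_ k)) h.
Proof.
move=> inc hM hh; apply: (@weakly_cvg_dense _ _ (fun k => Ln (n_ k))
  (fun k => Phi (n_ k)) (@subsequence_Phi_norm _ _ _ _ Phi_norm _ inc)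
  setT _ _ M) => //; first by move=> O [x Ox] _; exists x.
move=> d _.
have hd : dotp (h_ n) (Phi n d) @[n --> \oo] --> dotp h d.
  by apply: hh; exact: Phi_strongly_cvg.
exact: (cvg_comp n_ (fun n => dotp (h_ n) (Phi n d)) (homo_ltn_cvgy inc) hd).
Qed.

(** * From Mosco convergence through (F1) and (F2') to the resolvents *)

Lemma mosco_F2_F2' :
  mosco_F2 Phi E H En Hn -> mosco_F2' Phi E H En Hn a0.
Proof.
move=> F2 n_ inc u_ u Hu uu Hu' _; exists H; split=> // [w e Hw e0|v Hv].
  exists w => //; rewrite subrr form_normE (shift_form0l E_closed) ?sqrtr0//.
  exact: closed_form_domain0 E_closed.
have [w [Hw wu ww]] := extend_subsequence inc Hu uu.
have [v_ [Hv_ vv Evu]] := F2 w u Hw ww Hu' v Hv.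
exists (fun k => v_ (n_ k)); split=> //.
  exact: subsequence_strongly_cvg.
suff /cvg_limn_einf_sup[-> _] :
  (En (n_ k) (v_ (n_ k)) (u_ k))%:E @[k --> \oo] --> (E v u)%:E by [].
apply: cvg_EFin; first exact: nearW.
under eq_fun do rewrite -wu.
exact: (cvg_comp n_ (fun n => En n (v_ n) (w n)) (homo_ltn_cvgy inc) Evu).
Qed.

(** Whatever fills the gaps, the bound [M] is met infinitely often by the extended sequence, and
    this is all that the liminf in (F1) asks. *)
Lemma mosco_F1_subsequence (n_ : nat -> nat) (u_ : forall k, Ln (n_ k)) u
    (M : R) :
  mosco_F1 Phi H En Hn a0 ->
  {homo n_ : i j / (i < j)%N} -> (forall k, Hn (n_ k) (u_ k)) ->
  @weakly_cvg R L (fun k => Ln (n_ k)) (fun k => Phi (n_ k)) u_ u ->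
  0 <= M -> (forall k, (Theta (En (n_ k)) (Hn (n_ k)) a0 (u_ k) <= M%:E)%E) ->
  H u.
Proof.
move=> F1 inc Hu uu M0 TM; have [w [Hw wu ww]] := extend_subsequence inc Hu uu.
apply: (F1 w) => //; apply/limn_einf_lty; exists M => // N.
have [K _ /(_ K (leqnn K)) hK] := homo_ltn_cvgy inc (nbhs_infty_ge N).
by exists (n_ K) => //; rewrite wu.
Qed.

(** The [u_ n] are bounded, so every subsequence has a weakly convergent one. Its limit lies in [H]
    by (F1), solves the limit adjoint equation by (F2'), and is [u] by uniqueness. *)
Lemma adjoint_weakly_cvg a h_ h (M : R) u_ u :
  mosco_F1 Phi H En Hn a0 -> mosco_F2' Phi E H En Hn a0 -> a0 < a ->
  (forall n, `|h_ n| <= M) -> weakly_cvg Phi h_ h ->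
  (forall n, Hn n (u_ n)) ->
  (forall n v, Hn n v -> shift_form (En n) a v (u_ n) = dotp v (h_ n)) ->
  H u -> (forall v, H v -> shift_form E a v u = dotp v h) ->
  weakly_cvg Phi u_ u.
Proof.
move=> F1 F2' aa hM hh Hu_ hu_ Hu hu v_ v vv.
have M0 : 0 <= M := le_trans (normr_ge0 _) (hM 0%N).
pose M' := (a - a0)^-1 * M.
have a_gt0 : 0 <= (a - a0)^-1 by rewrite invr_ge0 subr_ge0 ltW.
have M'0 : 0 <= M' by rewrite mulr_ge0.
have uM' n : `|u_ n| <= M'.
  rewrite (le_trans (adjoint_le (En_closed n) aa (Hu_ n) (hu_ n)))//.
  by rewrite ler_wpM2l.
(* From [E^n_{a0+1} (w, u_n) = dotp w h_n + (a0 + 1 - a) * dotp w u_n], with [|u_n| <= M']. *)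
pose M'' := M + `|a0 + 1 - a| * M'.
have M''0 : 0 <= M'' by rewrite addr_ge0// mulr_ge0.
have TM n : (Theta (En n) (Hn n) a0 (u_ n) <= M''%:E)%E.
  apply/(Theta_leP (En_closed n) M''0 (Hu_ n)) => w Hw.
  rewrite (shift_formE _ _ a) hu_// /M'' [leRHS]mulrDl lerD//.
    rewrite (le_trans (dotp_le _ _))// mulrC ler_pM//.
    exact: (norm_le_form_norm (En_closed n)).
  rewrite (le_trans (ler_norm _))// normrM -mulrA ler_wpM2l//.
  rewrite (le_trans (cauchy_schwarz _ _))// mulrC ler_pM//.
  exact: (norm_le_form_norm (En_closed n)).
have limit p u' : {homo p : i j / (i < j)%N} ->
    @weakly_cvg R L (fun k => Ln (p k)) (fun k => Phi (p k))
      (fun k => u_ (p k)) u' -> u' = u.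
  move=> inc uu'.
  have Hu' : H u' by exact: (mosco_F1_subsequence F1 inc _ uu' M''0).
  have hh' := subsequence_weakly_cvg inc hM hh.
  have Tp : (ereal_sup (range (fun k =>
      Theta (En (p k)) (Hn (p k)) a0 (u_ (p k)))) < +oo)%E.
    apply: (@le_lt_trans _ _ M''%:E); last exact: ltry.
    by apply: ge_ereal_sup => _ [k _ <-].
  have [C [CH Cdense hC]] :=
    F2' p inc (fun k => u_ (p k)) u' (fun k => Hu_ (p k)) uu' Hu' Tp.
  (* The adjoint equation expresses [En] through inner products that converge, so the liminf of
     (F2') is a limit. *)
  have Cle w : C w -> dotp w h <= shift_form E a w u'.
    move=> Cw; have [w_ [Hw_ ww Ew]] := hC w Cw.
    move: Ew; have Ek k : En (p k) (w_ k) (u_ (p k)) =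
        dotp (h_ (p k)) (w_ k) - a * dotp (u_ (p k)) (w_ k).
      rewrite [dotp (h_ _) _]dotpC -hu_// /shift_form [dotp (u_ _) _]dotpC; ring.
    have Elim : En (p k) (w_ k) (u_ (p k)) @[k --> \oo] -->
        dotp h w - a * dotp u' w.
      under eq_fun do rewrite Ek.
      by apply: cvgB; [exact: hh'|apply: cvgMr; exact: uu'].
    have /cvg_limn_einf_sup[-> _] : (En (p k) (w_ k) (u_ (p k)))%:E
        @[k --> \oo] --> (dotp h w - a * dotp u' w)%:E.
      by apply: cvg_EFin => //; exact: nearW.
    by rewrite lee_fin /shift_form (dotpC w h) (dotpC w u') => ?; lra.
  have [K K0 hK] := shift_form_bounded E_closed a.
  have Hle w : H w -> dotp w h <= shift_form E a w u'.
    move=> Hw; rewrite -subr_le0.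
    apply: (@le0_eps _ (K * form_norm E a0 u' + `|h|)) => e e0.
    have [y Cy wy] := Cdense w e Hw e0; have Hy := CH y Cy.
    have HB := domB E_closed Hw Hy.
    have := Cle y Cy.
    have : dotp (w - y) h <= `|h| * e.
      rewrite (le_trans (dotp_le _ _))// mulrC ler_wpM2l//.
      by rewrite (le_trans (norm_le_form_norm E_closed HB))// ltW.
    have : - shift_form E a (w - y) u' <= K * form_norm E a0 u' * e.
      rewrite (le_trans (ler_norm _))// normrN (le_trans (hK _ _ _ _))//.
      by rewrite mulrAC ler_wpM2l ?mulr_ge0 ?form_norm_ge0// ltW.
    by rewrite dotpBl (shift_formBl E_closed)//; lra.
  apply: (adjoint_uniq E_closed aa Hu' Hu) hu => w Hw.
  apply/eqP; rewrite eq_le Hle// andbT.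
  (* The reverse inequality comes from [-w]. This waits until the inequality holds on all of [H],
     since [C] need not be stable under negation. *)
  have := Hle _ (domZ E_closed (-1) Hw).
  by rewrite dotpZl (shift_formZl E_closed)//; lra.
apply: contrapT => /cvgrPdist_lt/existsNP[e /not_implyP[e0 ne]].
have [|n_ inc hn] := @increasing_choice (fun _ n =>
    e <= `|dotp u v - dotp (u_ n) (v_ n)|).
  move=> _ N; apply: contrapT => nN; apply: ne; exists N => // n Nn /=.
  by rewrite ltNge; apply/negP => ?; apply: nN; exists n.
have [m_ incm [u' uu']] := @weakly_cvg_subsequence _ _ (fun k => Ln (n_ k))
  (fun k => Phi (n_ k)) (@subsequence_Phi_norm _ _ _ _ Phi_norm _ inc)
  (fun k => u_ (n_ k)) M' L_sep (fun k => uM' (n_ k)).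
have incp : {homo n_ \o m_ : i j / (i < j)%N} by move=> i j /incm/inc.
have u'u : u' = u by exact: (limit _ _ incp).
have := uu' _ _ (subsequence_strongly_cvg incp vv); rewrite u'u.
move=> /cvgrPdist_lt/(_ e e0)[K _ /(_ K (leqnn K))] /=.
by rewrite ltNge hn.
Qed.

(** Duality moves the resolvent onto [g_], where weak convergence suffices. Hence the lemma also
    applies with [g_ n] equal to [Gn n a (f_ n)], which yields the convergence of norms. *)
Lemma resolvent_pairing_cvg a f_ f g_ g (M : R) :
  mosco_F1 Phi H En Hn a0 -> mosco_F2' Phi E H En Hn a0 -> a0 < a ->
  strongly_cvg Phi f_ f -> (forall n, `|g_ n| <= M) -> weakly_cvg Phi g_ g ->
  dotp (Gn n a (f_ n)) (g_ n) @[n --> \oo] --> dotp (G a f) g.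
Proof.
move=> F1 F2' aa ff gM gg.
have adj n := cid2 (adjoint_exists (En_closed n) (Gn_res n) (g_ n) aa).
have [u Hu hu] := adjoint_exists E_closed G_res g aa.
pose u_ n := s2val (adj n).
have hu_ n v : Hn n v -> shift_form (En n) a v (u_ n) = dotp v (g_ n).
  exact: (s2valP' (adj n)).
have uu : weakly_cvg Phi u_ u.
  apply: (adjoint_weakly_cvg F1 F2' aa gM gg _ hu_ Hu hu) => n.
  exact: (s2valP (adj n)).
have Hu_ n : Hn n (u_ n) := s2valP (adj n).
rewrite -hu; last exact: (resolvent_domain G_res).
rewrite (resolvent_form G_res)// dotpC.
have -> : (fun n => dotp (Gn n a (f_ n)) (g_ n)) =
    (fun n => dotp (u_ n) (f_ n)); last exact: uu.
apply/funext => n; rewrite -hu_; last exact: (resolvent_domain (Gn_res n)).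
by rewrite (resolvent_form (Gn_res n))// dotpC.
Qed.

Lemma mosco_resolvent_cvg a :
  mosco_F1 Phi H En Hn a0 -> mosco_F2' Phi E H En Hn a0 -> a0 < a ->
  operators_strongly_cvg Phi (fun n => Gn n a) (G a).
Proof.
move=> F1 F2' aa f_ f ff; have [M fM] := strongly_bounded Phi_norm ff.
have a_gt0 : 0 <= (a - a0)^-1 by rewrite invr_ge0 subr_ge0 ltW.
have GM n : `|Gn n a (f_ n)| <= (a - a0)^-1 * M.
  by rewrite (le_trans (resolvent_le (Gn_res n) _ aa))// ler_wpM2l.
have Gw : weakly_cvg Phi (fun n => Gn n a (f_ n)) (G a f).
  move=> g_ g gg; have [M' gM'] := strongly_bounded Phi_norm gg.
  apply: (resolvent_pairing_cvg F1 F2' aa ff gM').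
  exact: (strongly_weakly_cvg Phi_norm).
apply: (weakly_strongly_cvg Phi_norm Gw).
exact: (resolvent_pairing_cvg F1 F2' aa ff GM Gw).
Qed.

(** * From convergence of the resolvents to (F1) and (F2) *)

Let b_gt : a0 < a0 + 1. Proof. by rewrite ltrDl. Qed.

Lemma resolvent_cvg_F1 :
  operators_strongly_cvg Phi (fun n => Gn n (a0 + 1)) (G (a0 + 1)) ->
  mosco_F1 Phi H En Hn a0.
Proof.
move=> Gcvg u_ u Hu uu /limn_einf_lty[M M0 TM].
suff uM g : dotp g u <= M * form_norm E a0 (G (a0 + 1) g).
  by have [] := resolvent_bounded_closure E_closed G_res b_gt M0 uM.
pose x_ n := Gn n (a0 + 1) (Phi n g).
have Hx n : Hn n (x_ n) by exact: (resolvent_domain (Gn_res n)).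
have Pg : strongly_cvg Phi (fun n => Phi n g) g by exact: Phi_strongly_cvg.
(* At the shift [a0 + 1] the form norm of a resolvent is an inner product under a root, so strong
   convergence of the resolvents carries over to form norms. *)
have normE (V : hilbertType R) (F : V -> V -> R) D T f :
    closed_form F D a0 -> resolvent_of F D a0 T ->
    form_norm F a0 (T (a0 + 1) f) = Num.sqrt (dotp f (T (a0 + 1) f)).
  move=> Fc Tr; rewrite form_normE (resolvent_form Tr)//.
  exact: (resolvent_domain Tr).
apply: (@cvg_le_frequently _ (fun n => dotp (Phi n g) (u_ n))
  (fun n => M * form_norm (En n) a0 (x_ n))).
- under eq_fun do rewrite dotpC.
  by rewrite dotpC; exact: uu.
- apply: cvgMr; rewrite (normE _ _ _ _ _ E_closed G_res).
  under eq_fun do rewrite (normE _ _ _ _ _ (En_closed _) (Gn_res _)).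
  apply: continuous_cvg; first exact: sqrt_continuous.
  apply: (strongly_weakly_cvg Phi_norm Pg); exact: Gcvg.
move=> N; have [n Nn Tn] := TM N; exists n => //.
rewrite -(resolvent_form (Gn_res n) _ b_gt (Hu n)).
exact: (Theta_leP (En_closed n) M0 (Hu n)).1.
Qed.

Lemma resolvent_cvg_F2 :
  operators_strongly_cvg Phi (fun n => Gn n (a0 + 1)) (G (a0 + 1)) ->
  mosco_F2 Phi E H En Hn.
Proof.
move=> Gcvg u_ u Hu_ uu Hu v Hv.
have [K K0 hK] := shift_form_bounded E_closed (a0 + 1).
pose err n (x : Ln n) := `|Phi n v - x| +
  `|shift_form E (a0 + 1) v u - shift_form (En n) (a0 + 1) x (u_ n)|.
(* [err] adds the errors in both requirements of (F2), so one near-minimizing choice meets both. In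
   the constant, 3 comes from [|Phi n v - x|], 1 from the weak convergence tested at [g], and
   [K * form_norm E a0 u] from replacing [v] by [G (a0 + 1) g]. *)
have [n|n x|e e0|x_ [Hx err0]] :=
    @cvg0_choice _ _ Hn err (4 + K * form_norm E a0 u).
- by exists 0; exact: closed_form_domain0 (En_closed n).
- by rewrite addr_ge0.
- have [g gv] := resolvent_dense E_closed G_res b_gt Hv e0.
  have HGg := resolvent_domain G_res g b_gt.
  have HB := domB E_closed HGg Hv.
  have Gv : `|v - G (a0 + 1) g| <= e.
    rewrite distrC (le_trans (norm_le_form_norm E_closed HB))//; exact: ltW.
  have Pg : strongly_cvg Phi (fun n => Phi n g) g by exact: Phi_strongly_cvg.
  have /cvgrPdist_le/(_ _ e0) := Gcvg _ _ Pg.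
  have /cvgrPdist_le/(_ _ e0) := uu _ _ Pg.
  have /cvgrPdist_le/(_ _ e0) := @Phi_norm (v - G (a0 + 1) g).
  apply: filterS3 => n PvG ug; rewrite sub0r normrN normr_id => Gg.
  exists (Gn n (a0 + 1) (Phi n g)); first exact: (resolvent_domain (Gn_res n)).
  have -> : (4 + K * form_norm E a0 u) * e =
    ((e + e) + e) + (e + K * form_norm E a0 u * e) by ring.
  apply: lerD.
    have -> : Phi n v - Gn n (a0 + 1) (Phi n g) = Phi n (v - G (a0 + 1) g) +
        (Phi n (G (a0 + 1) g) - Gn n (a0 + 1) (Phi n g)).
      by rewrite raddfB addrA subrK.
    rewrite (le_trans (ler_normD _ _))// lerD//.
    by move: PvG; rewrite distrC => /(le_trans (ler_norm _)) ?; lra.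
  rewrite (resolvent_form (Gn_res n))//.
  have -> : shift_form E (a0 + 1) v u - dotp (Phi n g) (u_ n) =
    (dotp u g - dotp (u_ n) (Phi n g))
     - shift_form E (a0 + 1) (G (a0 + 1) g - v) u.
    rewrite (shift_formBl E_closed)// (resolvent_form G_res)//.
    rewrite (dotpC u g) (dotpC (u_ n)); ring.
  rewrite (le_trans (ler_normB _ _))// lerD// (le_trans (hK _ _ _ _))//.
  by rewrite mulrAC ler_wpM2l ?mulr_ge0 ?form_norm_ge0// ltW.
have xv : strongly_cvg Phi x_ v.
  apply: cvg_norm_le err0 => n.
  by rewrite sub0r normrN normr_id lerDl.
exists x_; split=> //.
have sE : shift_form (En n) (a0 + 1) (x_ n) (u_ n) @[n --> \oo] -->
    shift_form E (a0 + 1) v u.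
  by apply: cvg_norm_le err0 => n; rewrite lerDr.
(* Removing the shift costs only [dotp (u_ n) (x_ n)], a weakly convergent sequence paired with a
   strongly convergent one. *)
have shiftE (V : hilbertType R) (F : V -> V -> R) x y :
    F x y = shift_form F (a0 + 1) x y - (a0 + 1) * dotp y x.
  by rewrite /shift_form (dotpC y x) addrK.
rewrite shiftE; under eq_fun do rewrite shiftE.
by apply: cvgB => //; apply: cvgMr; exact: uu.
Qed.

End Mosco.

Theorem theorem3p8 (R : realType) (L : hilbertType R)
    (Ln : nat -> hilbertType R)
    (L_sep : separable L) (Ln_sep : forall n, separable (Ln n))
    (Phi : forall n, {linear L -> Ln n})
    (Phi_norm : forall u : L, `|Phi n u| @[n --> \oo] --> `|u|)
    (a0 : R)
    (E : L -> L -> R) (H : set L)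
    (En : forall n, Ln n -> Ln n -> R) (Hn : forall n, set (Ln n))
    (E_closed : closed_form E H a0)
    (En_closed : forall n, closed_form (En n) (Hn n) a0)
    (G : R -> L -> L) (Gn : forall n, R -> Ln n -> Ln n)
    (G_res : resolvent_of E H a0 G)
    (Gn_res : forall n, resolvent_of (En n) (Hn n) a0 (Gn n)) :
  (mosco_cvg Phi E H En Hn a0 <->
     (mosco_F1 Phi H En Hn a0 /\ mosco_F2' Phi E H En Hn a0))
  /\
  (mosco_cvg Phi E H En Hn a0 <->
     (forall a : R, a0 < a ->
        operators_strongly_cvg Phi (fun n => Gn n a) (G a))).
Proof.
have weaken : mosco_cvg Phi E H En Hn a0 ->
    mosco_F1 Phi H En Hn a0 /\ mosco_F2' Phi E H En Hn a0.
  by move=> [F1 F2]; split=> //; exact: mosco_F2_F2'.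
have resolvents : mosco_F1 Phi H En Hn a0 /\ mosco_F2' Phi E H En Hn a0 ->
    forall a, a0 < a -> operators_strongly_cvg Phi (fun n => Gn n a) (G a).
  by move=> [F1 F2'] a aa;
  exact: (mosco_resolvent_cvg L_sep Phi_norm E_closed En_closed G_res Gn_res).
have mosco : (forall a, a0 < a ->
    operators_strongly_cvg Phi (fun n => Gn n a) (G a)) ->
    mosco_cvg Phi E H En Hn a0.
  have b_gt : a0 < a0 + 1 by rewrite ltrDl.
  move=> /(_ _ b_gt) Gcvg; split.
    exact: (resolvent_cvg_F1 Phi_norm E_closed En_closed G_res Gn_res).
  exact: (resolvent_cvg_F2 Phi_norm E_closed En_closed G_res Gn_res).
split; split; [exact: weaken|by move/resolvents/mosco|by move/weaken/resolvents|
  exact: mosco].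
Qed.
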